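(* For $m, n \geq 3$, the small Chvátal rank of $A\mathbf{x} \leq \mathbf{b}$ (and hence of $A$), with $A \in \mathbb{Z}^{m \times n}$ and $\mathbf{b} \in \mathbb{Z}^m$, can grow exponentially in the size of the input. That is, for all integers $m \geq n \geq 3$ there exist a constant $c > 0$ and a sequence of systems $A_j\mathbf{x} \leq \mathbf{b}_j$, with $A_j \in \mathbb{Z}^{m \times n}$ of rank $n$ with primitive rows and $\mathbf{b}_j \in \mathbb{Z}^m$, whose bit sizes $s_j$ tend to infinity and whose small Chvátal ranks are at least $2^{c s_j}$; hence the small Chvátal rank of each $A_j$ is also at least $2^{c s_j}$.
   Context: A vector in $\mathbb{Z}^n$ is primitive if the gcd of its components is one. The bit size of a system is the total binary encoding length of the entries of $A$ and $\mathbf{b}$. For $A \in \mathbb{Z}^{m \times n}$ of rank $n$ with primitive rows, let $\mathcal{A}$ be the set of rows of $A$. A basis in a set of vectors of $\mathbb{Z}^n$ is a subset of $n$ linearly independent vectors, and the cone generated by it is a basis cone. The minimal Hilbert basis of a pointed rational cone $K$ is the unique minimal finite set $H \subset K \cap \mathbb{Z}^n$ such that every element of $K \cap \mathbb{Z}^n$ is a nonnegative integer combination of elements of $H$. Set $\mathcal{A}^{(0)} = \mathcal{A}$, and for $k \geq 1$ let $\mathcal{A}^{(k)}$ be the union of the minimal Hilbert bases of all basis cones of $\mathcal{A}^{(k-1)}$; $A^{(k)}$ denotes a matrix whose rows are the elements of $\mathcal{A}^{(k)}$. With $Q_{\mathbf{b}} = \{\mathbf{x} \in \mathbb{R}^n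 : A\mathbf{x} \leq \mathbf{b}\}$ and $Q_{\mathbf{b}}^I = \mathrm{conv}(Q_{\mathbf{b}} \cap \mathbb{Z}^n)$, the small Chvátal rank (SCR) of $A\mathbf{x} \leq \mathbf{b}$ is the smallest $k$ such that there is an integer vector $\mathbf{b}'$ with $Q_{\mathbf{b}}^I = \{\mathbf{x} : A^{(k)}\mathbf{x} \leq \mathbf{b}'\}$. The SCR of $A$ is the supremum of the SCRs of $A\mathbf{x} \leq \mathbf{b}$ over $\mathbf{b} \in \mathbb{Z}^m$. *)

(* Defs.v *)
From mathcomp Require Import all_boot all_order all_algebra finmap.
From mathcomp Require Import all_classical all_reals all_analysis.

Set Implicit Arguments.
Unset Strict Implicit.
Unset Printing Implicit Defensive.

Import Order.TTheory GRing.Theory Num.Theory numFieldNormedType.Exports.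

Local Open Scope classical_set_scope.
Local Open Scope ring_scope.

Definition intmx (R : realType) (m n : nat) (M : 'M[int]_(m, n)) : 'M[R]_(m, n) :=
  map_mx intr M.
Arguments intmx R {m n} M.

Definition primitive (n : nat) (a : 'rV[int]_n) : Prop :=
  \big[gcdn/0%N]_(i < n) `|a 0%R i|%N = 1%N.

(* One sign bit and ceil(log2(|z| + 1)) bits for the absolute value. *)
Definition int_size (z : int) : nat := (up_log 2 `|z|.+1).+1.

Definition system_size (m n : nat) (A : 'M[int]_(m, n)) (b : 'cV[int]_m) : nat :=
  (\sum_(i < m) \sum_(j < n) int_size (A i j) + \sum_(i < m) int_size (b i 0%R))%N.

Definition cone (R : realType) (p n : nat) (B : 'M[int]_(p, n)) : set 'rV[R]_n :=
  [set x | exists l : 'rV[R]_p, (forall i, 0 <= l 0 i) /\ x = l *m intmx R B].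
Arguments cone R {p n} B.

(* A basis in a set of integer vectors, presented by a matrix whose rows are
   its elements; the order of the rows is irrelevant for the basis cone. *)
Definition is_basis (R : realType) (n : nat) (S : set 'rV[int]_n) (B : 'M[int]_n) : Prop :=
  (forall i, S (row i B)) /\ row_free (intmx R B).

Definition hilbert_basis (R : realType) (n : nat) (K : set 'rV[R]_n)
    (H : {fset 'rV[int]_n}) : Prop :=
  (forall h, h \in H -> K (intmx R h)) /\
  (forall z : 'rV[int]_n, K (intmx R z) ->
     exists c : 'rV[int]_n -> nat, z = \sum_(h <- H) h *+ c h).

Definition min_hilbert_basis (R : realType) (n : nat) (K : set 'rV[R]_n)
    (H : {fset 'rV[int]_n}) : Prop :=
  hilbert_basis K H /\
  (forall H' : {fset 'rV[int]_n}, (H' `<=` H)%fset -> hilbert_basis K H' -> H' = H).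

Definition basis_normalization (R : realType) (n : nat) (S : set 'rV[int]_n) :
    set 'rV[int]_n :=
  [set h | exists B : 'M[int]_n, is_basis R S B /\
     exists H : {fset 'rV[int]_n}, min_hilbert_basis (cone R B) H /\ h \in H].

(* The set of rows of A^(k). *)
Definition iterated_normalization (R : realType) (m n : nat) (A : 'M[int]_(m, n))
    (k : nat) : set 'rV[int]_n :=
  iter k (@basis_normalization R n) [set row i A | i in [set: 'I_m]].

Definition polyhedron (R : realType) (m n : nat) (A : 'M[int]_(m, n)) (b : 'cV[int]_m) :
    set 'cV[R]_n :=
  [set x | forall i, (intmx R A *m x) i 0 <= (b i 0)%:~R].
Arguments polyhedron R {m n} A b.

Definition conv (R : realType) (n : nat) (X : set 'cV[R]_n) : set 'cV[R]_n :=
  [set x | exists (p : nat) (l : 'I_p -> R) (v : 'I_p -> 'cV[R]_n),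
     (forall i, 0 <= l i) /\ \sum_(i < p) l i = 1 /\
     (forall i, X (v i)) /\ x = \sum_(i < p) l i *: v i].

Definition integer_hull (R : realType) (m n : nat) (A : 'M[int]_(m, n)) (b : 'cV[int]_m) :
    set 'cV[R]_n :=
  conv (polyhedron R A b `&` [set intmx R z | z in [set: 'cV[int]_n]]).
Arguments integer_hull R {m n} A b.

(* The right-hand side b' is indexed by the rows a of A^(k) themselves, so
   only its values on the set of these rows matter. *)
Definition scr_level (R : realType) (m n : nat) (A : 'M[int]_(m, n)) (b : 'cV[int]_m)
    (k : nat) : Prop :=
  exists b' : 'rV[int]_n -> int,
    integer_hull R A b =
    [set x : 'cV[R]_n | forall a, iterated_normalization R A k a ->
                          (intmx R a *m x) 0 0 <= (b' a)%:~R].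

(* k is the small Chvatal rank of the system A x <= b. *)
Definition is_scr (R : realType) (m n : nat) (A : 'M[int]_(m, n)) (b : 'cV[int]_m)
    (k : nat) : Prop :=
  scr_level R A b k /\ (forall k' : nat, scr_level R A b k' -> (k <= k')%N).

(* The small Chvatal rank of the matrix A, possibly +oo. *)
Definition scr_mx (R : realType) (m n : nat) (A : 'M[int]_(m, n)) : \bar R :=
  ereal_sup [set (k%:R)%:E | k in [set k : nat | exists b : 'cV[int]_m, is_scr R A b k]].

(* Main.v *)
Require Import Defs.
From mathcomp Require Import all_boot all_order all_algebra finmap.
From mathcomp Require Import all_classical all_reals all_analysis.
From mathcomp Require Import zify ring lra.
Import Order.TTheory GRing.Theory Num.Theory numFieldNormedType.Exports.
Local Open Scope classical_set_scope.
Local Open Scope ring_scope.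

(** For an integer [k > 0] consider in dimension 3 the system with rows
    [(k, 0, 1)], [b = (-1, 2, 0)], [(0, 0, 1)] and right-hand side [(0, 1, 0)];
    in higher dimension unit rows with right-hand side 0 are added, and extra
    rows repeat the third one.  Its small Chvatal rank is exactly [k], while
    its bit size is proportional to [log k]; the sequence takes [k = 2 ^ (j + 1)].

    The integer hull is the polyhedron cut by one more inequality, with normal
    [t = (0, k, 1)] and right-hand side 0 ([top_valid], [hull_of_ineqs]).  So the
    rank is the number of rounds after which [t] appears.  Call the last of the
    three coordinates the height, and the quotient of the middle one by the
    height the slope: [t] has slope [k], all rows but [b] have slope 0, and [b],
    of height 0, is infinitely steep.

    Slopes grow slowly.  An element of a minimal Hilbert basis is
    indecomposable, so unless it is [b] itself its coefficient on [b] is less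
    than 1.  Thus a basis cone that uses [b] adds less than 2, hence by
    integrality at most 1, to the middle coordinate, and after [d] rounds all
    vectors but [b] have slope at most [d] ([iterated_normalization_slope]).  A
    system with normals of slope at most [k - 1] that is valid for the hull
    keeps the point [(0, 1/2, - (k - 1) / 2)], which is outside the hull
    ([scr_level_ge]).

    Conversely slope 1 is gained in each round: among the vectors of the
    [r]-th round are [(k - r, r, 1)], [(0, r, 1)] and [b], and in their cone
    [(k - r - 1, r + 1, 1)] and [(0, r + 1, 1)] are indecomposable, hence belong
    to the minimal Hilbert basis ([iterated_normalization_stage]).  After [k]
    rounds both are [t]. *)

Set Implicit Arguments.
Unset Strict Implicit.
Unset Printing Implicit Defensive.

(** * Nonnegative integer combinations of a finite set *)

Section MonoidSpan.
Variable n : nat.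
Implicit Types (H : {fset 'rV[int]_n}) (z : 'rV[int]_n).

Definition monoid_span H : set 'rV[int]_n :=
  [set z | exists c : 'rV[int]_n -> nat, z = \sum_(h <- H) h *+ c h].

Lemma monoid_span0 H : monoid_span H 0.
Proof. by exists (fun=> 0%N); rewrite big1. Qed.

Lemma monoid_spanD H z1 z2 :
  monoid_span H z1 -> monoid_span H z2 -> monoid_span H (z1 + z2).
Proof.
move=> [c1 ->] [c2 ->]; exists (fun h => c1 h + c2 h)%N.
by rewrite -big_split; apply: eq_bigr => h _; rewrite mulrnDr.
Qed.

Lemma monoid_spanMn H z k : monoid_span H z -> monoid_span H (z *+ k).
Proof.
move=> Hz; elim: k => [|k IH]; first exact: monoid_span0.
by rewrite mulrS; exact: monoid_spanD.
Qed.

Lemma monoid_span_mem H h : h \in H -> monoid_span H h.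
Proof.
move=> hH; exists (fun x => (x == h) : nat).
rewrite (big_fsetD1 h) //= eqxx mulr1n big_seq big1 ?addr0 // => x.
by rewrite !inE => /andP[/negPf ->].
Qed.

Lemma monoid_span_trans H H' z :
  (forall h, h \in H -> monoid_span H' h) -> monoid_span H z ->
  monoid_span H' z.
Proof.
move=> sHH' [c ->]; rewrite big_seq; apply: big_ind.
- exact: monoid_span0.
- by move=> x y; exact: monoid_spanD.
- by move=> h /sHH' hs; exact: monoid_spanMn.
Qed.

Lemma monoid_span_sub H h (c : 'rV[int]_n -> nat) : h \in H -> (0 < c h)%N ->
  monoid_span H (\sum_(x <- H) x *+ c x - h).
Proof.
move=> hH ch; exists (fun x => c x - (x == h))%N.
rewrite !(big_fsetD1 h hH) /= eqxx addrAC.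
congr (_ + _); first by rewrite mulrnBr // mulr1n.
apply: eq_big_seq => x; rewrite !inE => /andP[/negPf -> _].
by rewrite subn0.
Qed.

(** Either [z] is a combination that avoids [h], or one copy of [h] can be
    taken out of it. *)
Lemma monoid_span_split H h z : h \in H -> monoid_span H z ->
  monoid_span (H `\ h)%fset z \/ exists2 z', monoid_span H z' & z = h + z'.
Proof.
move=> hH [c zE]; case: (posnP (c h)) => [ch0|chgt0].
  by left; exists c; rewrite zE (big_fsetD1 h) //= ch0 mulr0n add0r.
right; exists (z - h); last by rewrite addrC subrK.
by rewrite zE; exact: monoid_span_sub.
Qed.

End MonoidSpan.

(** * Integer matrices seen over the reals *)

Section IntegerMatrices.
Variable R : realType.

Lemma intmx_inj m p : injective (@intmx R m p).
Proof.
move=> M N /matrixP E; apply/matrixP=> i j.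
by have := E i j; rewrite !mxE => /intr_inj.
Qed.

Lemma intmxD m p (M N : 'M[int]_(m, p)) :
  intmx R (M + N) = intmx R M + intmx R N.
Proof. exact: map_mxD. Qed.

Lemma intmxN m p (M : 'M[int]_(m, p)) : intmx R (- M) = - intmx R M.
Proof. exact: map_mxN. Qed.

Lemma intmx0 m p : intmx R (0 : 'M[int]_(m, p)) = 0.
Proof. exact: map_mx0. Qed.

Lemma intmxB m p (M N : 'M[int]_(m, p)) :
  intmx R (M - N) = intmx R M - intmx R N.
Proof. exact: map_mxB. Qed.

Lemma intmx_row m p (M : 'M[int]_(m, p)) i : intmx R (row i M) = row i (intmx R M).
Proof. exact: map_row. Qed.

End IntegerMatrices.

(** * Hilbert bases of basis cones *)

Lemma bounded_fset n (M : nat) : exists H : {fset 'rV[int]_n},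
  forall z : 'rV[int]_n, (forall i, `|z 0 i| <= M%:Z) -> z \in H.
Proof.
pose g (f : {ffun 'I_n -> 'I_(2 * M).+1}) : 'rV[int]_n :=
  \row_i ((f i)%:Z - M%:Z).
exists [fset g f | f in {: {ffun 'I_n -> 'I_(2 * M).+1}}]%fset => z zM.
apply/imfsetP; exists [ffun i => inord (absz (z 0 i + M%:Z))] => //.
apply/rowP=> i; rewrite mxE ffunE.
have /andP[zl zu] : - M%:Z <= z 0 i <= M%:Z by rewrite -ler_norml.
have zMn : (absz (z 0%R i + M%:Z)%R < (2 * M).+1)%N by lia.
by rewrite inordK // gez0_abs ?addrK //; lia.
Qed.

Section SimplicialCone.
Variables (R : realType) (n : nat) (B : 'M[int]_n).
Hypothesis Bfree : row_free (intmx R B).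
Implicit Types (H : {fset 'rV[int]_n}) (z u v h : 'rV[int]_n).

Lemma cone0 : cone R B 0.
Proof. by exists 0; split=> [i|]; rewrite ?mxE // mul0mx. Qed.

Lemma coneD x y : cone R B x -> cone R B y -> cone R B (x + y).
Proof.
move=> [l [l0 ->]] [l' [l'0 ->]]; exists (l + l'); split; last by rewrite mulmxDl.
by move=> i; rewrite mxE addr_ge0.
Qed.

Lemma cone_pointed x : cone R B x -> cone R B (- x) -> x = 0.
Proof.
move=> [l [l0 ->]] [l' [l'0 E]].
have/(row_free_inj Bfree) : (l + l') *m intmx R B = 0 *m intmx R B.
  by rewrite mulmxDl -E subrr mul0mx.
move=> /rowP ll'; suff -> : l = 0 by rewrite mul0mx.
apply/rowP=> i; have := ll' i; rewrite !mxE => /eqP.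
by rewrite paddr_eq0 // => /andP[/eqP].
Qed.

Lemma cone_row i : cone R B (intmx R (row i B)).
Proof.
exists (delta_mx 0 i); split; last by rewrite -rowE intmx_row.
by move=> j; rewrite mxE ler0n.
Qed.

Lemma monoid_span_cone H z : (forall h, h \in H -> cone R B (intmx R h)) ->
  monoid_span H z -> cone R B (intmx R z).
Proof.
move=> HK [c ->]; rewrite big_seq.
apply: (big_ind (fun z => cone R B (intmx R z))).
- by rewrite intmx0; exact: cone0.
- by move=> x y xK yK; rewrite intmxD; exact: coneD.
- move=> h /HK hK; elim: (c h) => [|k IH]; first by rewrite mulr0n intmx0; exact: cone0.
  by rewrite mulrS intmxD; exact: coneD.
Qed.

(** The irreducible elements of the monoid of lattice points of the cone;
    they are exactly the members of its minimal Hilbert basis.  Both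
    inclusions are used: the first one bounds what a normalization creates,
    the second one produces new vectors. *)
Definition indecomposable z : Prop :=
  z != 0 /\ forall u v, cone R B (intmx R u) -> cone R B (intmx R v) ->
    z = u + v -> u = 0 \/ v = 0.

(** If [h = u + v] and [u], say, uses [h] in its expansion over [H], then
    [v + (u - h) = 0] and pointedness kills [v]; if neither summand uses
    [h], then [h] is redundant, against minimality. *)
Lemma min_hilbert_basis_irred H h u v :
  min_hilbert_basis (cone R B) H -> h \in H ->
  cone R B (intmx R u) -> cone R B (intmx R v) -> h = u + v -> u = 0 \/ v = 0.
Proof.
move=> [[HK Hgen] Hmin] hH uK vK hE.
have cancel x y z : cone R B (intmx R y) -> monoid_span H z -> x = h + z ->
    h = x + y -> y = 0.
  move=> yK /(monoid_span_cone HK) zK -> E.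
  apply: (@intmx_inj R); rewrite intmx0; apply: cone_pointed => //.
  rewrite -intmxN (_ : - y = z) //; apply/eqP.
  rewrite eq_sym -addr_eq0; apply/eqP.
  by apply: (addrI h); rewrite addr0 addrA -E.
have [uH'|[z zs uE]] := monoid_span_split hH (Hgen u uK); last first.
  by right; exact: (cancel u v z).
have [vH'|[z zs vE]] := monoid_span_split hH (Hgen v vK); last first.
  by left; apply: (cancel v u z) => //; rewrite addrC.
have : (H `\ h)%fset = H.
  apply: Hmin; first exact: fsubD1set.
  split=> [x|z zK]; first by rewrite !inE => /andP[_ /HK].
  apply: monoid_span_trans (Hgen z zK) => x xH.
  have [->|xh] := eqVneq x h; first by rewrite [X in monoid_span _ X]hE; exact: monoid_spanD.
  by apply: monoid_span_mem; rewrite !inE xh.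
by move/fsetP/(_ h); rewrite !inE eqxx hH.
Qed.

Lemma indecomposable_mem_hilbert_basis H z : hilbert_basis (cone R B) H ->
  cone R B (intmx R z) -> indecomposable z -> z \in H.
Proof.
move=> [HK Hgen] zK [z0 zind].
have [c zE] := Hgen z zK.
case: (pselect (exists2 h, h \in H & (h != 0) && (c h > 0)%N)) => [|none].
  move=> [h hH /andP[h0 ch]].
  have zS : monoid_span H (z - h) by rewrite zE; exact: monoid_span_sub.
  case: (zind h (z - h) (HK h hH) (monoid_span_cone HK zS)).
  - by rewrite addrC subrK.
  - by move/eqP; rewrite (negPf h0).
  - by move/eqP; rewrite subr_eq0 => /eqP ->.
case/eqP: z0; rewrite zE big_seq big1 // => h hH.
have [->|h0] := eqVneq h 0; first by rewrite mul0rn.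
case: (posnP (c h)) => [-> //|ch].
by case: none; exists h => //; rewrite h0.
Qed.

(** In a decomposition of row [i] all other coefficients vanish by
    independence, so both summands are multiples of the row; the unit entry
    makes the multiplier an integer between 0 and 1. *)
Lemma row_indecomposable i c : `|B i c|%N = 1%N -> indecomposable (row i B).
Proof.
move=> Bic; split.
  by apply/eqP => /rowP/(_ c) /eqP; rewrite !mxE -absz_eq0 Bic.
move=> u v [l [l0 uE]] [l' [l'0 vE]] E.
have/(row_free_inj Bfree)/rowP ll' : (l + l') *m intmx R B = delta_mx 0 i *m intmx R B.
  by rewrite mulmxDl -uE -vE -rowE -intmx_row E intmxD.
have lj j : j != i -> l 0 j = 0 /\ l' 0 j = 0.
  move=> ji; have := ll' j; rewrite !mxE (negPf ji) andbF => /eqP.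
  by rewrite paddr_eq0 // => /andP[/eqP ? /eqP].
have li : l 0 i + l' 0 i = 1 by have := ll' i; rewrite !mxE !eqxx.
have scale (w : 'rV[R]_n) : (forall j, j != i -> w 0 j = 0) ->
    w *m intmx R B = w 0 i *: intmx R (row i B).
  move=> w0; rewrite (_ : w = w 0 i *: delta_mx 0 i) ?scalemxAl.
    by rewrite -scalemxAl -rowE intmx_row !mxE !eqxx mulr1.
  apply/rowP=> j; rewrite !mxE eqxx /=; have [->|/w0 ->] := eqVneq j i.
    by rewrite mulr1.
  by rewrite mulr0.
rewrite scale in uE; last by move=> j /lj[].
rewrite scale in vE; last by move=> j /lj[].
have [s sE] : exists s : int, l 0 i = s%:~R.
  exists (u 0 c * B i c); have/rowP/(_ c) := uE.
  rewrite !mxE intrM => ->; rewrite -mulrA -intrM -[LHS]mulr1; congr (_ * _).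
  by have [->|->] : B i c = 1 \/ B i c = -1 by lia.
have s0 : 0 <= s by have := l0 i; rewrite sE ler0z.
have s1 : s <= 1 by rewrite -(ler_int R) -sE -li lerDl.
have : (s == 0) || (s == 1) by lia.
case/orP=> /eqP sv.
  left; apply: (@intmx_inj R); rewrite uE sE sv intmx0; exact: scale0r.
right; apply: (@intmx_inj R); rewrite vE intmx0 (_ : l' 0 i = 0) ?scale0r //.
by apply: (addrI (l 0 i)); rewrite li sE sv addr0.
Qed.

(** Gordan's lemma.  The lattice points of a closed box containing the
    fundamental parallelepiped generate: subtracting integral parts of the
    coefficients leaves a point of the parallelepiped. *)
Lemma hilbert_basis_exists : exists H, hilbert_basis (cone R B) H.
Proof.
pose M : nat := (\sum_i \sum_j `|B i j|)%N.
have [S SM] := bounded_fset n M.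
pose H := [fset x in S | `[< cone R B (intmx R x) >]]%fset.
have inH z : (z \in H) = (z \in S) && `[< cone R B (intmx R z) >] by rewrite !inE.
exists H; split=> [h|z [l [l0 zE]]]; first by rewrite inH => /andP[_ /asboolP].
pose fl : 'I_n -> nat := fun i => absz (Num.floor (l 0 i)).
have flE i : (fl i)%:R = (Num.floor (l 0 i))%:~R :> R.
  by rewrite /fl natr_absz ger0_norm ?floor_ge0.
pose fr : 'rV[R]_n := \row_i (l 0 i - (fl i)%:R).
have fr0 i : 0 <= fr 0 i by rewrite mxE flE subr_ge0 ge_floor.
have fr1 i : fr 0 i <= 1.
  by rewrite mxE flE lerBlDr addrC -intrD1 ltW // lt_succ_floor.
pose z0 := z - \sum_i row i B *+ fl i.
have z0E : intmx R z0 = fr *m intmx R B.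
  rewrite intmxB zE (_ : fr = l - \row_i (fl i)%:R); last first.
    by apply/rowP=> i; rewrite !mxE.
  rewrite mulmxBl; congr (_ - _).
  apply/rowP=> c; rewrite !mxE summxE raddf_sum; apply: eq_bigr => i _.
  by rewrite !mxE mulmxnE !mxE raddfMn /= mulr_natl.
have z0H : z0 \in H.
  rewrite inH; apply/andP; split; last by apply/asboolP; exists fr; split.
  apply: SM => c; rewrite -(ler_int R) intr_norm.
  have -> : (z0 0 c)%:~R = (fr *m intmx R B) 0 c by rewrite -z0E [RHS]mxE.
  rewrite mxE.
  apply: (le_trans (ler_norm_sum _ _ _)).
  rewrite /M -[leRHS]/((\sum_i \sum_j `|B i j|)%N%:R) natr_sum.
  apply: ler_sum => i _; rewrite normrM (ger0_norm (fr0 i)) [intmx R B i c]mxE.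
  apply: (@le_trans _ _ `|(B i c)%:~R|); first by rewrite ler_piMl.
  rewrite natr_sum (bigD1 c) //= -intr_norm -abszE lerDl sumr_ge0 //.
rewrite (_ : z = z0 + \sum_i row i B *+ fl i); last by rewrite subrK.
apply: monoid_spanD; first exact: monoid_span_mem.
apply: (big_ind (monoid_span H)).
- exact: monoid_span0.
- by move=> x y; exact: monoid_spanD.
move=> i _; apply/monoid_spanMn/monoid_span_mem.
rewrite inH; apply/andP; split; last by apply/asboolP; exact: cone_row.
apply: SM => c; rewrite mxE -abszE lez_nat /M.
by rewrite (bigD1 i) //= (bigD1 c) //= -addnA leq_addr.
Qed.

Lemma min_hilbert_basis_exists : exists H, min_hilbert_basis (cone R B) H.
Proof.
have [H0 H0h] := hilbert_basis_exists.
have [N] := ubnP #|` H0|; elim: N => // N IH in H0 H0h *; rewrite ltnS => HN.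
case: (pselect (exists2 H', (H' `<=` H0)%fset /\ hilbert_basis (cone R B) H' & H' <> H0)).
  move=> [H' [sH' H'h] /eqP neq]; apply: (IH H') => //.
  apply: leq_trans HN; apply: fproper_ltn_card.
  by rewrite fproperEneq neq.
move=> none; exists H0; split=> // H' sH' H'h.
by apply/eqP/negP => /negP/eqP neq; apply: none; exists H'.
Qed.

Lemma indecomposable_mem_normalization (S : set 'rV[int]_n) z :
  (forall i, S (row i B)) -> cone R B (intmx R z) -> indecomposable z ->
  basis_normalization R S z.
Proof.
move=> BS zK zi; exists B; split=> //.
have [H Hmin] := min_hilbert_basis_exists; exists H; split=> //.
by apply: indecomposable_mem_hilbert_basis => //; case: Hmin.
Qed.

End SimplicialCone.

(** * Convex hulls and recession directions *)

Section Conv.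
Variables (R : realType) (n : nat).
Implicit Types (X : set 'cV[R]_n) (x y : 'cV[R]_n).

Lemma conv_segment X x y (t : R) : 0 <= t <= 1 -> Defs.conv X x -> Defs.conv X y ->
  Defs.conv X ((1 - t) *: x + t *: y).
Proof.
move=> /andP[t0 t1] [p [l [v [l0 [l1 [vX ->]]]]]] [q [l' [v' [l'0 [l'1 [v'X ->]]]]]].
exists (p + q)%N.
exists (fun i => match fintype.split i with inl a => (1 - t) * l a | inr b => t * l' b end).
exists (fun i => match fintype.split i with inl a => v a | inr b => v' b end).
split; first by move=> i; case: (fintype.split _) => a; rewrite mulr_ge0 // subr_ge0.
split.
  rewrite big_split_ord /=.
  under eq_bigr do rewrite (unsplitK (inl _)).
  under [X in _ + X]eq_bigr do rewrite (unsplitK (inr _)).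
  by rewrite -!mulr_sumr l1 l'1 !mulr1 subrK.
split; first by move=> i; case: (fintype.split _).
rewrite big_split_ord /= !scaler_sumr; congr (_ + _); apply: eq_bigr => i _.
  by rewrite (unsplitK (inl _)) scalerA.
by rewrite (unsplitK (inr _)) scalerA.
Qed.

Lemma conv3 X x y z (a b c : R) : 0 <= a -> 0 <= b -> 0 <= c -> a + b + c = 1 ->
  X x -> X y -> X z -> Defs.conv X (a *: x + b *: y + c *: z).
Proof.
move=> a0 b0 c0 abc Xx Xy Xz; exists 3%N.
exists (fun i : 'I_3 => nth 0 [:: a; b; c] i), (fun i : 'I_3 => nth 0 [:: x; y; z] i).
split; first by move=> [[|[|[|i]]] Hi].
split; first by rewrite !big_ord_recl big_ord0 /= addr0 addrA.
split; first by move=> [[|[|[|i]]] Hi].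
by rewrite !big_ord_recl big_ord0 /= addr0 addrA.
Qed.

(** A set stable only under integral steps along [r] has a hull stable
    under real ones: the point lies between [x] and [x + N r] for a large
    integer [N]. *)
Lemma conv_recession X r x (s : R) : (forall v, X v -> X (v + r)) -> 0 <= s ->
  Defs.conv X x -> Defs.conv X (x + s *: r).
Proof.
move=> Xr s0 Xx.
have XrN N v : X v -> X (v + r *+ N).
  by move=> Xv; elim: N => [|N IH]; rewrite ?mulr0n ?addr0 // mulrSr addrA; exact: Xr.
pose N := (Num.truncn s).+1.
have sN : s < N%:R by exact: truncnS_gt.
have N0 : (0 : R) < N%:R by rewrite ltr0n.
have -> : x + s *: r = (1 - s / N%:R) *: x + (s / N%:R) *: (x + r *+ N).
  rewrite scalerDr addrA -scalerDl subrK scale1r -(scaler_nat N r) scalerA divfK //.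
  by rewrite gt_eqF.
apply: conv_segment => //.
  apply/andP; split; first by rewrite divr_ge0 // ltW.
  by rewrite ler_pdivrMr // mul1r ltW.
case: Xx => [p [l [v [l0 [l1 [vX ->]]]]]].
exists p, l, (fun i => v i + r *+ N); split=> //; split=> //.
split; first by move=> i; exact: XrN.
by under [RHS]eq_bigr do rewrite scalerDr; rewrite big_split /= -scaler_suml l1 scale1r.
Qed.

Lemma conv_recession_sum X (I : finType) (r : I -> 'cV[R]_n) x (s : I -> R) :
  (forall i v, X v -> X (v + r i)) -> (forall i, 0 <= s i) ->
  Defs.conv X x -> Defs.conv X (x + \sum_i s i *: r i).
Proof.
move=> Xr s0 Xx; elim: (index_enum I) => [|i e IH]; first by rewrite big_nil addr0.
rewrite big_cons addrCA addrC; apply: conv_recession => //; exact: Xr.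
Qed.

Lemma conv_ineq X (a : 'rV[R]_n) (beta : R) x :
  (forall v, X v -> (a *m v) 0 0 <= beta) -> Defs.conv X x -> (a *m x) 0 0 <= beta.
Proof.
move=> Xa [p [l [v [l0 [l1 [vX ->]]]]]].
rewrite -[beta]mul1r -l1 mulr_suml mulmx_sumr summxE.
by apply: ler_sum => i _; rewrite -scalemxAr mxE ler_wpM2l // Xa.
Qed.

Lemma conv_sub X x : X x -> Defs.conv X x.
Proof.
move=> Xx; exists 1%N, (fun=> 1), (fun=> x); split=> //.
by rewrite !big_ord1 scale1r.
Qed.

End Conv.

(** * Systems with repeated rows *)

(** Everything in the definition of the small Chvatal rank depends only on
    the set of inequalities, so a square system can be padded with copies of
    its rows to any larger number of rows. *)
Section RepeatedRows.
Variables (R : realType) (m p n : nat) (f : 'I_m -> 'I_p).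
Variables (A : 'M[int]_(p, n)) (b : 'cV[int]_p).
Hypothesis f_surj : forall i, exists i', f i' = i.

Lemma polyhedron_rowsub : polyhedron R (rowsub f A) (rowsub f b) = polyhedron R A b.
Proof.
have E i (x : 'cV[R]_n) : (intmx R (rowsub f A) *m x) i 0 = (intmx R A *m x) (f i) 0.
  rewrite !mxE; by apply: eq_bigr => j _; rewrite !mxE.
apply/seteqP; split=> x Hx i /=.
  by have [i' <-] := f_surj i; have := Hx i'; rewrite E [rowsub f b _ _]mxE.
by rewrite E [rowsub f b _ _]mxE; exact: Hx.
Qed.

Lemma iterated_normalization_rowsub k :
  iterated_normalization R (rowsub f A) k = iterated_normalization R A k.
Proof.
congr iter; apply/seteqP; split=> _ [i _ <-].
  by exists (f i) => //; apply/rowP=> j; rewrite !mxE.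
have [i' <-] := f_surj i; exists i' => //; apply/rowP=> j; rewrite !mxE //.
Qed.

Lemma scr_level_rowsub k :
  scr_level R (rowsub f A) (rowsub f b) k = scr_level R A b k.
Proof.
by rewrite /scr_level /integer_hull polyhedron_rowsub iterated_normalization_rowsub.
Qed.

Lemma mxrank_rowsub : \rank (intmx R A) = n -> \rank (intmx R (rowsub f A)) = n.
Proof.
move=> rA; apply/eqP; rewrite eqn_leq rank_leq_col /= -{1}rA mxrankS //.
apply/row_subP => i; have [i' <-] := f_surj i.
have -> : row (f i') (intmx R A) = row i' (intmx R (rowsub f A)).
  by apply/rowP=> j; rewrite !mxE.
exact: row_sub.
Qed.

End RepeatedRows.

(** * Normalization stays inside the cone of the rows *)

Section NormalizationCone.
Variables (R : realType) (m n : nat) (A : 'M[int]_(m, n)).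

Lemma iterated_normalization_ge0 (y : 'cV[R]_n) :
  (forall i, 0 <= (intmx R A *m y) i 0) ->
  forall k a, iterated_normalization R A k a -> 0 <= (intmx R a *m y) 0 0.
Proof.
move=> Ay; elim=> [|k IH] a.
  by move=> [i _ <-]; rewrite intmx_row -row_mul mxE.
move=> [B [[BS _] [H [[[HK _] _] aH]]]].
have [l [l0 ->]] := HK a aH.
rewrite -mulmxA mxE sumr_ge0 // => i _; rewrite mulr_ge0 //.
have := IH _ (BS i); rewrite intmx_row -row_mul mxE //.
Qed.

End NormalizationCone.

(** * The matrices and their coordinates *)

(** The rows are [(k - r, r, 1)], [(-1, 2, 0)], [(0, r, 1)] and the unit
    vectors of the remaining coordinates.  Stage 0 is the matrix of the
    system; the rows of stage [r] span the basis cone of the [r]-th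
    normalization that creates the vectors of the next round.  At [r = k] the
    first and the third row coincide with the missing facet normal. *)
Definition stage_entry (k r i c : nat) : int :=
  match i, c with
  | 0%N, 0%N => k%:Z - r%:Z
  | 0%N, 1%N => r%:Z
  | 0%N, 2%N => 1
  | 1%N, 0%N => -1
  | 1%N, 1%N => 2
  | 2%N, 1%N => r%:Z
  | _, _ => (i == c)%:Z
  end.

Definition stage n (k r : nat) : 'M[int]_n := \matrix_(i, c) stage_entry k r i c.

Definition stage_rhs n : 'cV[int]_n := \col_i (i == 1 :> nat)%:Z.

Section Coordinates.
Variable n : nat.

Definition i0 : 'I_n.+3 := ord0.
Definition i1 : 'I_n.+3 := lift ord0 ord0.
Definition i2 : 'I_n.+3 := lift ord0 (lift ord0 ord0).

(** Three coordinates carry all the geometry; the others behave alike. *)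
Lemma ord3_ind (P : 'I_n.+3 -> Prop) :
  P i0 -> P i1 -> P i2 -> (forall i : 'I_n.+3, (2 < i)%N -> P i) -> forall i, P i.
Proof.
move=> P0 P1 P2 Pn i.
case: (ltnP 2 i) => [/Pn //|]; rewrite leq_eqVlt => /orP[/eqP i2E|].
  by rewrite (_ : i = i2) //; apply: val_inj.
rewrite ltnS leq_eqVlt => /orP[/eqP i1E|].
  by rewrite (_ : i = i1) //; apply: val_inj.
rewrite ltnS leqn0 => /eqP i0E.
by rewrite (_ : i = i0) //; apply: val_inj.
Qed.

Lemma sum_ord3 (V : zmodType) (F : 'I_n.+3 -> V) :
  (forall i : 'I_n.+3, (2 < i)%N -> F i = 0) -> \sum_i F i = F i0 + F i1 + F i2.
Proof.
move=> F0; rewrite 3!big_ord_recl big1 ?addr0 ?addrA // => i _.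
exact: F0.
Qed.

Lemma sum_ord1 (V : zmodType) (F : 'I_n.+3 -> V) (c : 'I_n.+3) :
  (forall i : 'I_n.+3, i != c -> F i = 0) -> \sum_i F i = F c.
Proof. by move=> F0; rewrite (bigD1 c) //= big1 ?addr0. Qed.

Variables (R : realType) (k r : nat).
Local Notation B := (stage n.+3 k r).

Lemma stage_entry_large (i c : nat) : (2 < i)%N || (2 < c)%N ->
  stage_entry k r i c = (i == c)%:Z.
Proof. by case: i => [|[|[|i]]]; case: c => [|[|[|c]]]. Qed.

Lemma stage_large (i c : 'I_n.+3) : (2 < i)%N || (2 < c)%N ->
  intmx R B i c = (i == c)%:R.
Proof. by move=> ic; rewrite !mxE stage_entry_large. Qed.

Lemma mul_row_stage0 (l : 'rV[R]_n.+3) :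
  (l *m intmx R B) 0 i0 = l 0 i0 * (k%:R - r%:R) - l 0 i1.
Proof.
rewrite mxE sum_ord3 => [|i i_gt2].
  by rewrite !mxE /=; rewrite rmorphB /= mulr0 addr0 mulrN1.
by rewrite stage_large ?i_gt2 ?orbT // -val_eqE; case: i i_gt2 => [[|[|[|i]]]] //= *; rewrite ?mulr0 ?mul0r.
Qed.

Lemma mul_row_stage1 (l : 'rV[R]_n.+3) :
  (l *m intmx R B) 0 i1 = l 0 i0 * r%:R + l 0 i1 * 2 + l 0 i2 * r%:R.
Proof.
rewrite mxE sum_ord3 => [|i i_gt2]; first by rewrite !mxE.
by rewrite stage_large ?i_gt2 ?orbT // -val_eqE; case: i i_gt2 => [[|[|[|i]]]] //= *; rewrite ?mulr0 ?mul0r.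
Qed.

Lemma mul_row_stage2 (l : 'rV[R]_n.+3) :
  (l *m intmx R B) 0 i2 = l 0 i0 + l 0 i2.
Proof.
rewrite mxE sum_ord3 => [|i i_gt2].
  by rewrite !mxE /=; rewrite !mulr1 mulr0 addr0.
by rewrite stage_large ?i_gt2 ?orbT // -val_eqE; case: i i_gt2 => [[|[|[|i]]]] //= *; rewrite ?mulr0 ?mul0r.
Qed.

Lemma mul_row_stageS (l : 'rV[R]_n.+3) (c : 'I_n.+3) : (2 < c)%N ->
  (l *m intmx R B) 0 c = l 0 c.
Proof.
move=> c2; rewrite mxE (sum_ord1 (c := c)) => [|i ic]; rewrite stage_large ?c2 ?orbT //.
  by rewrite eqxx mulr1.
by rewrite (negPf ic) mulr0.
Qed.

Lemma mul_stage0 (x : 'cV[R]_n.+3) :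
  (intmx R B *m x) i0 0 = (k%:R - r%:R) * x i0 0 + r%:R * x i1 0 + x i2 0.
Proof.
rewrite mxE sum_ord3 => [|i i_gt2].
  by rewrite !mxE /=; rewrite rmorphB /= mul1r.
by rewrite stage_large ?i_gt2 ?orbT // -val_eqE; case: i i_gt2 => [[|[|[|i]]]] //= *; rewrite ?mulr0 ?mul0r.
Qed.

Lemma mul_stage1 (x : 'cV[R]_n.+3) :
  (intmx R B *m x) i1 0 = - x i0 0 + 2 * x i1 0.
Proof.
rewrite mxE sum_ord3 => [|i i_gt2].
  by rewrite !mxE /=; rewrite mulN1r mul0r addr0.
by rewrite stage_large ?i_gt2 ?orbT // -val_eqE; case: i i_gt2 => [[|[|[|i]]]] //= *; rewrite ?mulr0 ?mul0r.
Qed.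

Lemma mul_stage2 (x : 'cV[R]_n.+3) :
  (intmx R B *m x) i2 0 = r%:R * x i1 0 + x i2 0.
Proof.
rewrite mxE sum_ord3 => [|i i_gt2].
  by rewrite !mxE /=; rewrite mul1r mul0r add0r.
by rewrite stage_large ?i_gt2 ?orbT // -val_eqE; case: i i_gt2 => [[|[|[|i]]]] //= *; rewrite ?mulr0 ?mul0r.
Qed.

Lemma mul_stageS (x : 'cV[R]_n.+3) (c : 'I_n.+3) : (2 < c)%N ->
  (intmx R B *m x) c 0 = x c 0.
Proof.
move=> c2; rewrite mxE (sum_ord1 (c := c)) => [|i ic]; rewrite stage_large ?c2 ?orbT //.
  by rewrite eqxx mul1r.
by rewrite eq_sym (negPf ic) mul0r.
Qed.

Lemma stage_free : (r < k)%N -> row_free (intmx R B).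
Proof.
move=> rk; apply: inj_row_free => l /rowP lB.
have kr : (0 : R) < k%:R - r%:R by rewrite subr_gt0 ltr_nat.
have E0 := lB i0; have E1 := lB i1; have E2 := lB i2.
rewrite mul_row_stage0 mxE in E0; rewrite mul_row_stage1 mxE in E1.
rewrite mul_row_stage2 mxE in E2.
have l2 : l 0 i2 = - l 0 i0 by apply/eqP; rewrite eq_sym -subr_eq0 -opprD oppr_eq0 E2.
have l1 : l 0 i1 = 0 by rewrite l2 in E1; lra.
have l0 : l 0 i0 = 0.
  by move/eqP: E0; rewrite l1 subr0 mulf_eq0 (gt_eqF kr) orbF => /eqP.
apply/rowP; apply: ord3_ind => [|||c c2]; rewrite mxE //.
  by rewrite l2 l0 oppr0.
by have := lB c; rewrite mul_row_stageS // mxE.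
Qed.

End Coordinates.

(** * Growth of the normalizations *)

Section Vectors.
Variable n : nat.

Definition vec3 (V : zmodType) (x y z : V) : 'cV[V]_n.+3 :=
  \col_i nth 0 [:: x; y; z] i.

Lemma vec3_large (V : zmodType) (x y z : V) (i : 'I_n.+3) : (2 < i)%N ->
  vec3 x y z i 0 = 0.
Proof. by move=> i2; rewrite mxE nth_default. Qed.

Lemma mul_vec3 (R : realType) (a : 'rV[int]_n.+3) (x y z : R) :
  (intmx R a *m vec3 x y z) 0 0 =
  (a 0 (i0 n))%:~R * x + (a 0 (i1 n))%:~R * y + (a 0 (i2 n))%:~R * z.
Proof.
rewrite mxE sum_ord3 => [|i i2]; first by rewrite !mxE.
by rewrite vec3_large // mulr0.
Qed.

Lemma intmx_vec3 (R : realType) (x y z : int) :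
  intmx R (vec3 x y z) = vec3 x%:~R y%:~R z%:~R.
Proof.
apply/colP; apply: ord3_ind => [|||i i2]; rewrite !mxE //.
by rewrite !nth_default.
Qed.

Definition slice_pt (x : int) (j : nat) : 'rV[int]_n.+3 := (vec3 x j%:Z 1)^T.

End Vectors.

Section Growth.
Variables (R : realType) (n k : nat).
Local Notation B r := (stage n.+3 k r).
Local Notation i0 := (i0 n).
Local Notation i1 := (i1 n).
Local Notation i2 := (i2 n).
Implicit Types (S : set 'rV[int]_n.+3) (r : nat).

Lemma row_stage0 r : row i0 (B r) = slice_pt n (k%:Z - r%:Z) r.
Proof.
apply/rowP; apply: ord3_ind => [|||c c2]; rewrite !mxE //.
by rewrite nth_default // stage_entry_large ?c2 ?orbT //; case: c c2 => [[]].
Qed.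

Lemma row_stage2 r : row i2 (B r) = slice_pt n 0 r.
Proof.
apply/rowP; apply: ord3_ind => [|||c c2]; rewrite !mxE //.
by rewrite nth_default // stage_entry_large ?c2 ?orbT //; case: c c2 => [[|[|[]]]].
Qed.

Lemma row_stage_const r r' (i : 'I_n.+3) : i != i0 -> i != i2 ->
  row i (B r) = row i (B r').
Proof.
by move=> ni0 ni2; apply/rowP=> c; rewrite !mxE; case: i ni0 ni2 => [[|[|[|i]]]].
Qed.

(** The last of the three coordinates is a nonnegative integer on the cone,
    and equals 1 here, so one summand has it equal to 0.  Such a summand is an
    integral multiple of [(-1, 2, 0)]; were the multiplier positive, the other
    summand would have middle coordinate at most [r - 1], while on the cone it
    is at least [r] times the last one. *)
Lemma slice_pt_indecomposable r x : (r < k)%N ->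
  indecomposable R (B r) (slice_pt n x r.+1).
Proof.
move=> rk; split; first by apply/eqP => /rowP/(_ i2); rewrite !mxE.
pose coneB u := cone R (B r) (intmx R u).
have core u v : coneB u -> coneB v -> slice_pt n x r.+1 = u + v ->
    u 0 i2 = 0 -> u = 0.
  move=> [l [l0 /rowP uE]] [l' [l'0 /rowP vE]] /rowP E u2.
  have {}uE i : (u 0 i)%:~R = (l *m intmx R (B r)) 0 i by rewrite -uE mxE.
  have {}vE i : (v 0 i)%:~R = (l' *m intmx R (B r)) 0 i by rewrite -vE mxE.
  have := uE i2; rewrite u2 mul_row_stage2 => /esym/eqP.
  rewrite paddr_eq0 // => /andP[/eqP l00 /eqP l20].
  have := uE i0; rewrite mul_row_stage0 l00 mul0r sub0r => u0E.
  have := uE i1; rewrite mul_row_stage1 l00 l20 !mul0r add0r addr0 => u1E.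
  have := E i2; rewrite !mxE /= u2 add0r => v2E.
  have := vE i2; rewrite mul_row_stage2 -v2E => l'sum.
  have := vE i1; rewrite mul_row_stage1 => v1E.
  have v1r : r%:Z <= v 0 i1.
    rewrite -(ler_int R) v1E addrAC -mulrDl -l'sum mul1r lerDl mulr_ge0 //.
  have := E i1; rewrite !mxE /= => u1v1.
  have u1u0 : u 0 i1 = - (u 0 i0 * 2).
    by apply: (@intr_inj R); rewrite u1E rmorphN rmorphM /= u0E mulNr opprK.
  have u0_le0 : u 0 i0 <= 0 by rewrite -(ler_int R) u0E oppr_le0.
  have u0 : u 0 i0 = 0 by lia.
  apply/rowP; apply: ord3_ind => [|||c c2]; rewrite [RHS]mxE //.
    by rewrite u1u0 u0.
  have ucvc : (u 0 c + v 0 c)%R = 0%R :> int.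
    by have := E c; rewrite !mxE nth_default // => <-.
  have uc0 : 0 <= u 0 c by rewrite -(ler_int R) uE mul_row_stageS.
  have vc0 : 0 <= v 0 c by rewrite -(ler_int R) vE mul_row_stageS.
  by have : (u 0 c)%R = 0%R :> int by lia.
have nonneg u : coneB u -> 0 <= u 0 i2.
  move=> [l [l0 /rowP/(_ i2)]]; rewrite mul_row_stage2 mxE => uE.
  by rewrite -(ler_int R) uE addr_ge0.
move=> u v uK vK E; have := nonneg u uK; have := nonneg v vK.
have := E => /rowP/(_ i2); rewrite !mxE /= => uv2 v2 u2.
have /orP[/eqP u20|/eqP v20] : (u 0 i2 == 0) || (v 0 i2 == 0) by lia.
  by left; exact: (core u v).
by right; apply: (core v u) => //; rewrite addrC.
Qed.

(** The coefficients are [t] and [1 - t] on the two rows of height 1, and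
    one half on [(-1, 2, 0)], which lifts the middle coordinate from [r] to
    [r + 1]. *)
Lemma slice_pt_mem_cone r x (t : R) : 0 <= t <= 1 ->
  (k%:R - r%:R) * t = x%:~R + 2^-1 -> cone R (B r) (intmx R (slice_pt n x r.+1)).
Proof.
move=> /andP[t0 t1] tE; exists (vec3 n t 2^-1 (1 - t))^T.
split.
  apply: ord3_ind => [|||c c2]; rewrite !mxE //=.
  - by rewrite subr_ge0.
  - by rewrite nth_default.
apply/rowP; apply: ord3_ind => [|||c c2].
- by rewrite mul_row_stage0 !mxE /= mulrC tE addrK.
- by rewrite mul_row_stage1 !mxE /= -pmulrn -natr1; field.
- by rewrite mul_row_stage2 !mxE /= addrC subrK.
- by rewrite mul_row_stageS // !mxE !nth_default.
Qed.

Lemma normalization_stage S r : (r < k)%N -> (forall i, S (row i (B r))) ->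
  forall i, basis_normalization R S (row i (B r)).
Proof.
move=> rk SB i; have Bfree := @stage_free n R k r rk.
apply: (indecomposable_mem_normalization Bfree SB); first exact: cone_row.
elim/ord3_ind: i => [|||i i2].
- by apply: (@row_indecomposable R _ _ Bfree i0 i2); rewrite mxE.
- by apply: (@row_indecomposable R _ _ Bfree i1 i0); rewrite mxE.
- by apply: (@row_indecomposable R _ _ Bfree i2 i2); rewrite mxE.
- by apply: (@row_indecomposable R _ _ Bfree i i); rewrite mxE stage_entry_large ?i2 // eqxx.
Qed.

Lemma normalization_stage_next S r : (r < k)%N -> (forall i, S (row i (B r))) ->
  forall i, basis_normalization R S (row i (B r.+1)).
Proof.
move=> rk SB i; have Bfree := @stage_free n R k r rk.
have kr : (1 : R) <= k%:R - r%:R by rewrite lerBrDr nat1r ler_nat.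
have kr0 : (0 : R) < k%:R - r%:R by apply: lt_le_trans kr.
have t01 : (0 : R) <= (2 * (k%:R - r%:R))^-1 <= (1 : R).
  by rewrite invr_ge0 mulr_ge0 ?(ltW kr0) //= invf_le1 ?mulr_gt0 //; lra.
have [->|ni0] := eqVneq i i0.
  rewrite row_stage0; apply: (indecomposable_mem_normalization Bfree SB).
    apply: (@slice_pt_mem_cone _ _ (1 - (2 * (k%:R - r%:R))^-1)).
      by move: t01; lra.
    rewrite rmorphB /= -!pmulrn -natr1.
    by field; rewrite gt_eqF.
  exact: slice_pt_indecomposable.
have [->|ni2] := eqVneq i i2.
  rewrite row_stage2; apply: (indecomposable_mem_normalization Bfree SB).
    apply: (@slice_pt_mem_cone _ _ (2 * (k%:R - r%:R))^-1) => //.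
    by field; rewrite gt_eqF.
  exact: slice_pt_indecomposable.
rewrite (row_stage_const r.+1 r ni0 ni2); exact: normalization_stage.
Qed.

(** The rows of stage 0 have to be carried along: besides the new facet
    normal, the description of the hull uses the original ones. *)
Lemma iterated_normalization_stage r : (0 < k)%N -> (r <= k)%N ->
  (forall i, iterated_normalization R (B 0) r (row i (B 0))) /\
  (forall i, iterated_normalization R (B 0) r (row i (B r))).
Proof.
move=> k0; elim: r => [_|r IH rk]; first by split=> i; exists i.
have [S0 Sr] := IH (ltnW rk); split=> i.
  exact: normalization_stage.
exact: normalization_stage_next.
Qed.

End Growth.

(** * Each normalization raises the slope by at most one *)

Section Invariant.
Variables (R : realType) (n k : nat).
Local Notation A := (stage n.+3 k 0).
Local Notation i0 := (i0 n).
Local Notation i1 := (i1 n).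
Local Notation i2 := (i2 n).
Local Notation b := (row i1 A).

(** These are inequalities of the cone of the rows.  Together they say that
    a vector of height 0 is an integral multiple of [(-1, 2, 0)] in the first
    coordinates; in particular its middle entry is even. *)
Lemma iterated_normalization_ineq d (a : 'rV[int]_n.+3) :
  iterated_normalization R A d a ->
  [/\ 0 <= a 0 i2, 0 <= a 0 i0 * 2 + a 0 i1 &
      a 0 i0 * 2 + a 0 i1 <= k%:Z * 2 * a 0 i2].
Proof.
move=> aS.
have nonneg (x y z : R) : 0 <= k%:R * x + z -> 0 <= - x + 2 * y -> 0 <= z ->
    0 <= (a 0 i0)%:~R * x + (a 0 i1)%:~R * y + (a 0 i2)%:~R * z.
  move=> h0 h1 h2; rewrite -mul_vec3.
  apply: (iterated_normalization_ge0 _ aS); apply: ord3_ind => [|||i i_gt2].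
  - by rewrite mul_stage0 !mxE /= subr0 mul0r addr0.
  - by rewrite mul_stage1 !mxE.
  - by rewrite mul_stage2 !mxE /= mul0r add0r.
  - by rewrite mul_stageS // vec3_large.
have k0 : (0 : R) <= k%:R by rewrite ler0n.
split; rewrite -(ler_int R) ?rmorphD ?rmorphM /= -?pmulrn.
- have H : 0 <= k%:R * 0 + 1 :> R by rewrite mulr0 add0r.
  by have := nonneg 0 0 1 H ltac:(lra) ltac:(lra); lra.
- have H : 0 <= k%:R * 2 + 0 :> R by rewrite addr0 mulr_ge0.
  by have := nonneg 2 1 0 H ltac:(lra) ltac:(lra); lra.
- have H : 0 <= k%:R * (- 2) + k%:R * 2 :> R by rewrite mulrN addNr.
  have H' : 0 <= k%:R * 2 :> R by rewrite mulr_ge0.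
  by have := nonneg (- 2) (- 1) (k%:R * 2) H ltac:(lra) H'; lra.
Qed.

(** The steep vector [b = (-1, 2, 0)] is the only source of growth.  An
    indecomposable vector other than [b] has coefficient less than 1 on [b],
    so [b] adds less than 2 to its middle coordinate; by integrality the
    excess over [d] times the height is at most 1.  A height of at least 1
    absorbs it; at height 0 the middle coordinate is even and below 2. *)
Lemma iterated_normalization_slope d (a : 'rV[int]_n.+3) :
  iterated_normalization R A d a -> a = b \/ a 0 i1 <= d%:Z * a 0 i2.
Proof.
elim: d a => [|d IH] a aS.
  case: aS => i _ <-; elim/ord3_ind: i => [|||i i_gt2].
  - by right; rewrite !mxE.
  - by left.
  - by right; rewrite !mxE.
  - right; rewrite !mxE !stage_entry_large ?i_gt2 // mul0r.
    by case: i i_gt2 => [[|[]]].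
have [a2 a0 a0k] := iterated_normalization_ineq aS.
case: aS => B [[BS Bfree] [H [Hmin aH]]].
have aK : cone R B (intmx R a) by case: Hmin => [[HK _] _]; exact: HK.
case: (aK) => l [l0 aE].
have aEc c : (a 0 c)%:~R = \sum_i l 0 i * (B i c)%:~R :> R.
  by have /rowP/(_ c) := aE; rewrite !mxE => ->; apply: eq_bigr => i _; rewrite mxE.
have slope i : row i B <> b -> l 0 i * (B i i1)%:~R <= d%:R * (l 0 i * (B i i2)%:~R).
  move=> neq; case: (IH _ (BS i)) => // ; rewrite !mxE => Bi.
  rewrite mulrCA ler_wpM2l // -[d%:R]/(d%:Z%:~R) -rmorphM /= ler_int //.
case: (pselect (exists i, row i B = b)) => [[i iB]|none]; last first.
  right; rewrite -(ler_int R) (@le_trans _ _ (d%:R * (a 0 i2)%:~R)) //.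
    rewrite !aEc mulr_sumr; apply: ler_sum => i _; apply: slope => E.
    by apply: none; exists i.
  rewrite rmorphM /= ler_wpM2r ?ler0z // -pmulrn ler_nat //.
have other j : j != i -> row j B <> b.
  move=> ji E; have /(row_free_inj Bfree)/rowP/(_ j) :
      (delta_mx 0 j : 'rV[R]_n.+3) *m intmx R B = delta_mx 0 i *m intmx R B.
    by rewrite -!rowE -!intmx_row E iB.
  by rewrite !mxE !eqxx (negPf ji) => /eqP; rewrite oner_eq0.
have Bi1 : B i i1 = 2 by have /rowP/(_ i1) := iB; rewrite !mxE.
have Bi2 : B i i2 = 0 by have /rowP/(_ i2) := iB; rewrite !mxE.
case: (lerP 1 (l 0 i)) => [l1|l1].
  left; have := @min_hilbert_basis_irred R _ B Bfree H a b (a - b) Hmin aH.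
  case.
  - by rewrite -iB; exact: cone_row.
  - exists (l - delta_mx 0 i); split; last first.
      by rewrite mulmxBl -rowE -intmx_row iB intmxB aE.
    move=> j; rewrite !mxE eqxx /=; case: eqP => [->|_]; first by rewrite subr_ge0.
    by rewrite subr0.
  - by rewrite addrC subrK.
  - by move/rowP/(_ i1); rewrite !mxE.
  - by move/eqP; rewrite subr_eq0 => /eqP.
right; have : a 0 i1 < d%:Z * a 0 i2 + 2.
  rewrite -(ltr_int R) rmorphD rmorphM /= -!pmulrn !aEc mulr_sumr.
  rewrite [ltLHS](bigD1 i) //= [X in _ < X + _](bigD1 i) //= Bi1 Bi2 !mulr0 add0r addrC.
  apply: ler_ltD; first by apply: ler_sum => j /other; exact: slope.
  by rewrite gtr_pMl.
have [a2_0|a2_pos] := eqVneq (a 0 i2) 0; last by nia.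
by move: a0k; rewrite a2_0 !mulr0 => a0k a1; lia.
Qed.

End Invariant.

(** * The integer hull of the system *)

Section Hull.
Variables (R : realType) (n k : nat).
Hypothesis k_gt0 : (0 < k)%N.
Local Notation A := (stage n.+3 k 0).
Local Notation rhs := (stage_rhs n.+3).
Local Notation i0 := (i0 n).
Local Notation i1 := (i1 n).
Local Notation i2 := (i2 n).
Local Notation Q := (polyhedron R A rhs).
Local Notation QZ := (Q `&` [set intmx R z | z in [set: 'cV[int]_n.+3]]).
Local Notation top := (slice_pt n 0 k).

Let kR_gt0 : (0 : R) < k%:R. Proof. by rewrite ltr0n. Qed.

Lemma polyhedron_stage (x : 'cV[R]_n.+3) :
  Q x <-> [/\ k%:R * x i0 0 + x i2 0 <= 0, - x i0 0 + 2 * x i1 0 <= 1,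
             x i2 0 <= 0 & forall i : 'I_n.+3, (2 < i)%N -> x i 0 <= 0].
Proof.
split=> [Hx|[H0 H1 H2 Hi]].
  split=> [|||i i_gt2].
  - by have := Hx i0; rewrite mul_stage0 mxE subr0 mul0r addr0.
  - by have := Hx i1; rewrite mul_stage1 mxE.
  - by have := Hx i2; rewrite mul_stage2 mxE mul0r add0r.
  - have := Hx i; rewrite mul_stageS // mxE.
    by case: eqP => // i1E; rewrite i1E in i_gt2.
apply: ord3_ind => [|||i i_gt2].
- by rewrite mul_stage0 mxE subr0 mul0r addr0.
- by rewrite mul_stage1 mxE.
- by rewrite mul_stage2 mxE mul0r add0r.
- rewrite mul_stageS // mxE; case: eqP => [i1E|_]; last exact: Hi.
  by rewrite i1E in i_gt2.
Qed.

Lemma mul_top (x : 'cV[R]_n.+3) :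
  (intmx R top *m x) 0 0 = k%:R * x i1 0 + x i2 0.
Proof.
rewrite mxE sum_ord3 => [|i i_gt2]; last by rewrite !mxE nth_default // mul0r.
by rewrite !mxE /= mul0r add0r mul1r.
Qed.

(** On an integer point [k x_1 + x_2 <= 0]: this is clear for [x_1 <= 0],
    and otherwise [x_0 >= 2 x_1 - 1 >= x_1], hence
    [x_2 <= - k x_0 <= - k x_1]. *)
Lemma top_valid x : integer_hull R A rhs x -> (intmx R top *m x) 0 0 <= 0.
Proof.
rewrite /integer_hull; apply: conv_ineq => v [/polyhedron_stage[H0 H1 H2 _] [z _ zE]]; subst v.
rewrite !mxE in H0 H1 H2.
have {}H0 : k%:Z * z i0 0 + z i2 0 <= 0.
  by rewrite -(lerz0 R) rmorphD rmorphM /= -pmulrn.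
have {}H1 : - z i0 0 + 2 * z i1 0 <= 1.
  by rewrite -(ler_int R) rmorphD rmorphN rmorphM.
have {}H2 : z i2 0 <= 0 by rewrite -(lerz0 R).
suff : k%:Z * z i1 0 + z i2 0 <= 0.
  by rewrite mul_top !mxE -(lerz0 R) rmorphD rmorphM /= -pmulrn.
have k0 : 0 < k%:Z by [].
have [z1|z1] := lerP (z i1 0) 0; first by nia.
by nia.
Qed.

Lemma vec3_hull (x y z : int) :
  k%:Z * x + z <= 0 -> - x + 2 * y <= 1 -> z <= 0 -> QZ (vec3 n x%:~R y%:~R z%:~R).
Proof.
move=> H0 H1 H2; split; last by exists (vec3 n x y z) => //; exact: intmx_vec3.
apply/polyhedron_stage; split=> [|||i i_gt2]; last by rewrite vec3_large.
- by move: H0; rewrite !mxE -(lerz0 R) rmorphD rmorphM /= -pmulrn.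
- by move: H1; rewrite !mxE -(ler_int R) rmorphD rmorphN rmorphM.
- by rewrite mxE lerz0.
Qed.


(** The columns of the inverse of the matrix, negated and scaled to integer
    vectors: they generate the recession cone of the polyhedron. *)
Definition recession_dir (i : 'I_n.+3) : 'cV[int]_n.+3 :=
  match val i with
  | 0%N => vec3 n (- 2) (- 1) 0
  | 1%N => vec3 n 0 (- 1) 0
  | 2%N => vec3 n 2 1 (- (2 * k%:Z))
  | _ => - delta_mx i 0
  end.

Lemma recession_dir_large (i : 'I_n.+3) : (2 < i)%N ->
  recession_dir i = - delta_mx i 0.
Proof. by rewrite /recession_dir; case: i => [[|[|[|i]]]]. Qed.

Lemma mul_vec3_le0 (x y z : int) :
  k%:Z * x + z <= 0 -> - x + 2 * y <= 0 -> z <= 0 ->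
  forall j, (intmx R A *m intmx R (vec3 n x y z)) j 0 <= 0.
Proof.
move=> H0 H1 H2; rewrite intmx_vec3; apply: ord3_ind => [|||j j_gt2].
- rewrite mul_stage0 !mxE /= subr0 mul0r addr0.
  by move: H0; rewrite -(lerz0 R) rmorphD rmorphM /= -pmulrn.
- by rewrite mul_stage1 !mxE /=; move: H1; rewrite -(lerz0 R) rmorphD rmorphN rmorphM.
- by rewrite mul_stage2 !mxE /= mul0r add0r lerz0.
- by rewrite mul_stageS // vec3_large.
Qed.

Lemma recession_dirP i v : QZ v -> QZ (v + intmx R (recession_dir i)).
Proof.
move=> [Qv [z _ zE]]; split; last first.
  by exists (z + recession_dir i) => //; rewrite intmxD zE.
have dir_le0 j : (intmx R A *m intmx R (recession_dir i)) j 0 <= 0.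
  elim/ord3_ind: i => [|||i i_gt2]; last first.
    rewrite recession_dir_large // intmxN mulmxN /intmx map_delta_mx -colE !mxE.
    by rewrite stage_entry_large ?i_gt2 ?orbT // oppr_le0 ler0z.
  - by rewrite /recession_dir /=; apply: mul_vec3_le0; lia.
  - by rewrite /recession_dir /=; apply: mul_vec3_le0; lia.
  - by rewrite /recession_dir /=; apply: mul_vec3_le0; lia.
by move=> j; rewrite mulmxDr mxE -[leRHS]addr0 lerD.
Qed.

(** Work in the slacks [y_0], [y_1], [y_2], scaled so that the facet is
    [y_0 + y_1 + y_2 >= 1] in the nonnegative orthant.  Dividing by
    [y_0 + y_1 + y_2] projects radially to the triangle spanned by the three
    integer points [(-1, 0, 0)], [0] and [(1, 1, -k)], and the remaining part
    is a recession direction. *)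
Lemma hull_of_ineqs x : Q x -> (intmx R top *m x) 0 0 <= 0 -> integer_hull R A rhs x.
Proof.
move=> /polyhedron_stage[H0 H1 H2 Hi]; rewrite mul_top => Htop.
pose y0 := - (k%:R * x i0 0 + x i2 0) / k%:R.
pose y1 := 1 + x i0 0 - 2 * x i1 0.
pose y2 := - x i2 0 / k%:R.
have y0_ge0 : 0 <= y0 by rewrite divr_ge0 // ?oppr_ge0 // ltW.
have y1_ge0 : 0 <= y1 by rewrite /y1; lra.
have y2_ge0 : 0 <= y2 by rewrite divr_ge0 // ?oppr_ge0 // ltW.
have x0E : x i0 0 = y2 - y0 by rewrite /y0 /y2; field; rewrite gt_eqF.
have x1E : 2 * x i1 0 = 1 + x i0 0 - y1 by rewrite /y1; lra.
have x2E : x i2 0 = - (k%:R * y2) by rewrite /y2; field; rewrite gt_eqF.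
have sum_ge1 : 1 <= y0 + y1 + y2.
  have : x i1 0 <= y2 by rewrite -(ler_pM2l kR_gt0); lra.
  lra.
pose t := (y0 + y1 + y2)^-1.
have t_gt0 : 0 < t by rewrite invr_gt0; lra.
have tE : t * (y0 + y1 + y2) = 1 by rewrite mulVf // gt_eqF //; lra.
have t_le1 : t <= 1 by rewrite invf_le1 //; lra.
pose s i : R := match val i with
  | 0%N => (1 - t) * y0 / 2 | 1%N => (1 - t) * y1 / 2 | 2%N => (1 - t) * y2 / 2
  | _ => - x i 0 end.
have -> : x = ((t * y0) *: vec3 n (- 1)%:~R 0%:~R 0%:~R
    + (t * y1) *: vec3 n 0%:~R 0%:~R 0%:~R
    + (t * y2) *: vec3 n 1%:~R 1%:~R (- k%:Z)%:~R)
    + \sum_i s i *: intmx R (recession_dir i).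
  apply/colP; apply: ord3_ind => [|||i i_gt2].
  - rewrite mxE summxE sum_ord3 => [|i i_gt2]; last first.
      by rewrite recession_dir_large // !mxE; case: i i_gt2 => [[]] //= *; rewrite oppr0 mulr0.
    rewrite !mxE /s /= x0E; lra.
  - rewrite mxE summxE sum_ord3 => [|i i_gt2]; last first.
      by rewrite recession_dir_large // !mxE; case: i i_gt2 => [[|[]]] //= *; rewrite oppr0 mulr0.
    rewrite !mxE /s /=; lra.
  - rewrite mxE summxE sum_ord3 => [|i i_gt2]; last first.
      by rewrite recession_dir_large // !mxE; case: i i_gt2 => [[|[|[]]]] //= *; rewrite oppr0 mulr0.
    rewrite !mxE /s /= x2E; lra.
  - rewrite mxE summxE (sum_ord1 (c := i)) => [|j ji].
      rewrite recession_dir_large // !mxE /s !eqxx nth_default //.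
      case: i i_gt2 => [[|[|[|i]]]] //= *. by rewrite !nth_nil !mulr0 !add0r rmorphN mulrNN mulr1.
    elim/ord3_ind: j ji => [|||j j_gt2] ji.
    + by rewrite /recession_dir !mxE nth_default // mulr0.
    + by rewrite /recession_dir !mxE nth_default // mulr0.
    + by rewrite /recession_dir !mxE nth_default // mulr0.
    + by rewrite recession_dir_large // !mxE eq_sym (negPf ji) oppr0 mulr0.
apply: conv_recession_sum.
- exact: recession_dirP.
- apply: ord3_ind => [|||i i_gt2].
  + by rewrite /s /= divr_ge0 // mulr_ge0 // subr_ge0.
  + by rewrite /s /= divr_ge0 // mulr_ge0 // subr_ge0.
  + by rewrite /s /= divr_ge0 // mulr_ge0 // subr_ge0.
  + rewrite /s; have := Hi i i_gt2; case: i i_gt2 => [[|[|[|i]]]] //= *.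
    by rewrite oppr_ge0.
have t_ge0 := ltW t_gt0.
apply: conv3; [exact: mulr_ge0|exact: mulr_ge0|exact: mulr_ge0| | | |].
- by rewrite -!mulrDr.
- by apply: vec3_hull; clear; lia.
- by apply: vec3_hull; clear; lia.
- by apply: vec3_hull; clear; lia.
Qed.

End Hull.

(** * The small Chvatal rank equals k *)

Section SmallChvatalRank.
Variables (R : realType) (n k : nat).
Hypothesis k_gt0 : (0 < k)%N.
Local Notation A := (stage n.+3 k 0).
Local Notation rhs := (stage_rhs n.+3).
Local Notation i0 := (i0 n).
Local Notation i1 := (i1 n).
Local Notation i2 := (i2 n).
Local Notation top := (slice_pt n 0 k).

(** The coefficients of [a] over the rows are nonnegative dual multipliers,
    hence they bound [a] on the polyhedron; on integer points the bound can be
    rounded down. *)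
Lemma iterated_normalization_le_floor d (a : 'rV[int]_n.+3) x :
  iterated_normalization R A d a -> integer_hull R A rhs x ->
  (intmx R a *m x) 0 0 <=
    (Num.floor ((intmx R a *m invmx (intmx R A) *m intmx R rhs) 0 0))%:~R.
Proof.
move=> aS; rewrite /integer_hull; apply: conv_ineq => v [Qv [z _ zE]]; subst v.
rewrite -map_mxM mxE ler_int floor_ge_int.
have -> : ((a *m z) 0 0)%:~R = (intmx R a *m intmx R z) 0 0.
  by rewrite -map_mxM [RHS]mxE.
have Aunit : intmx R A \in unitmx by rewrite -row_free_unit; exact: stage_free.
rewrite -subr_ge0.
have -> : (intmx R a *m invmx (intmx R A) *m intmx R rhs) 0 0 -
   (intmx R a *m intmx R z) 0 0 =
   (intmx R a *m (invmx (intmx R A) *m (intmx R rhs - intmx R A *m intmx R z))) 0 0.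
  by rewrite !mulmxBr mulKmx // mulmxA [RHS]mxE [X in _ = _ + X]mxE.
apply: (iterated_normalization_ge0 _ aS) => i.
rewrite mulKVmx // mxE [X in _ + X]mxE subr_ge0 [leRHS]mxE.
exact: Qv.
Qed.

Lemma scr_level_top : scr_level R A rhs k.
Proof.
exists (fun a => if a == top then 0
  else Num.floor ((intmx R a *m invmx (intmx R A) *m intmx R rhs) 0 0)).
have [rowA rowB] := @iterated_normalization_stage R n k k k_gt0 (leqnn k).
have Aunit : intmx R A \in unitmx by rewrite -row_free_unit; exact: stage_free.
apply/seteqP; split=> x /= Hx.
  move=> a aS; case: eqP => [->|_]; first exact: top_valid.
  exact: iterated_normalization_le_floor aS Hx.
apply: hull_of_ineqs => //; last first.
  have := Hx top; rewrite eqxx; apply.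
  by have := rowB i2; rewrite row_stage2.
move=> i; have := Hx _ (rowA i); rewrite intmx_row -row_mul mxE.
case: eqP => [_|_] /le_trans; apply; rewrite ler_int.
  by rewrite mxE.
by rewrite -mulmxA -row_mul mulKVmx // [X in Num.floor X]mxE [X in Num.floor X]mxE intrKfloor.
Qed.

Lemma iterated_normalization_row d i :
  iterated_normalization R A d (row i A).
Proof.
elim: d i => [|d IH] i; first by exists i.
exact: normalization_stage.
Qed.

(** The point [x] is cut off by the missing facet only.  A normal [a] of
    slope at most [k - 1] takes at [x] a value at most 0, its value at the
    integer point 0; the steep row takes the value 1, which it also attains at
    the integer point [(-1, 0, 0)].  So [x] satisfies every system that is
    valid for the hull and uses only normals of fewer than [k] rounds. *)
Lemma scr_level_ge d : scr_level R A rhs d -> (k <= d)%N.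
Proof.
move=> [b' hullE]; rewrite leqNgt; apply/negP => dk.
pose x : 'cV[R]_n.+3 := vec3 n 0 2^-1 (- (k%:R - 1) / 2).
have b'_ge (y : 'cV[int]_n.+3) a : polyhedron R A rhs (intmx R y) ->
    iterated_normalization R A d a -> (intmx R a *m intmx R y) 0 0 <= (b' a)%:~R.
  move=> Qy aS.
  have : integer_hull R A rhs (intmx R y) by apply: conv_sub; split=> //; exists y.
  by rewrite hullE => /(_ _ aS).
have : integer_hull R A rhs x.
  rewrite hullE /= => a aS; rewrite mul_vec3.
  have [->|slope] := iterated_normalization_slope aS.
    have := b'_ge (vec3 n (- 1) 0 0) _ _ (iterated_normalization_row d i1).
    rewrite intmx_vec3 mul_vec3 !mxE /= => vertex.
    apply: le_trans (vertex _); first by lra.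
    by have [] := @vec3_hull R n k (- 1) 0 0 ltac:(lia) ltac:(lia) ltac:(lia).
  have := b'_ge 0 a _ aS; rewrite intmx0 mulmx0 mxE => origin.
  apply: le_trans (origin _); last first.
    by apply/polyhedron_stage; split=> [|||i _]; rewrite !mxE; lra.
  have [a2 _ _] := iterated_normalization_ineq aS.
  have {}a2 : 0 <= (a 0 i2)%:~R :> R by rewrite ler0z.
  have {}slope : (a 0 i1)%:~R <= d%:R * (a 0 i2)%:~R :> R.
    by move: slope; rewrite -(ler_int R) rmorphM /= -pmulrn.
  have : d%:R * (a 0 i2)%:~R <= (k%:R - 1) * (a 0 i2)%:~R :> R.
    by rewrite ler_wpM2r // lerBrDr natr1 ler_nat.
  by lra.
move/(top_valid k_gt0); rewrite mul_top !mxE /=; lra.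
Qed.

Lemma is_scr_stage : is_scr R A rhs k.
Proof. by split; [exact: scr_level_top | exact: scr_level_ge]. Qed.

End SmallChvatalRank.

(** * Bit size and conclusion *)

Lemma stage_unit_entry n k r (i : 'I_n.+3) : exists c, absz (stage n.+3 k r i c) = 1%N.
Proof.
elim/ord3_ind: i => [|||i i_gt2].
- by exists (i2 n); rewrite mxE.
- by exists (i0 n); rewrite mxE.
- by exists (i2 n); rewrite mxE.
- by exists i; rewrite mxE stage_entry_large ?i_gt2 // eqxx.
Qed.

Lemma primitive_unit_entry n (a : 'rV[int]_n) c : absz (a 0 c) = 1%N -> primitive a.
Proof.
move=> ac; apply/eqP; rewrite -dvdn1.
by apply: (@biggcdn_inf _ c) => //; rewrite ac.
Qed.

Lemma int_size_le z e : (absz z <= 2 ^ e)%N -> (int_size z <= e.+2)%N.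
Proof.
move=> ze; rewrite ltnS up_log_min // expnS mul2n -addnn -addn1 addnC.
by rewrite leq_add // expn_gt0.
Qed.

Lemma int_size_gt z e : (2 ^ e <= absz z)%N -> (e < int_size z)%N.
Proof.
move=> ez; rewrite ltnS ltnW // -(@ltn_exp2l 2) //.
by apply: leq_trans (up_logP _ _); rewrite // ltnS.
Qed.

Section RepeatedStage.
Variables (m n : nat).
Hypothesis nm : (n.+3 <= m)%N.

Definition fold_row (i : 'I_m) : 'I_n.+3 :=
  inord (if (i < n.+3)%N then i : nat else 2).

Lemma fold_row_surj i : exists i', fold_row i' = i.
Proof.
exists (widen_ord nm i); apply: val_inj.
by rewrite /fold_row /= ltn_ord inordK.
Qed.

Lemma system_size_le e : (0 < e)%N ->
  (system_size (rowsub fold_row (stage n.+3 (2 ^ e) 0))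
     (rowsub fold_row (stage_rhs n.+3)) <= (m * n.+3 + m) * e.+2)%N.
Proof.
move=> e0; have e2 : (2 <= 2 ^ e)%N by rewrite -{1}(expn1 2) leq_exp2l.
rewrite /system_size mulnDl leq_add //.
  rewrite -mulnA -[X in (X * _)%N]card_ord -sum_nat_const leq_sum // => i _.
  rewrite -[X in (X * _)%N]card_ord -sum_nat_const leq_sum // => c _.
  apply: int_size_le; rewrite !mxE; move: (nat_of_ord (fold_row i)) (nat_of_ord c).
  case=> [|[|[|a]]] [|[|[|d]]] //=; rewrite ?(ltnW e2) //; first by lia.
  by case: eqP => _; rewrite ?(ltnW e2).
rewrite -[X in (X * _)%N]card_ord -sum_nat_const leq_sum // => i _.
by apply: int_size_le; rewrite !mxE; case: eqP => _; rewrite ?(ltnW e2).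
Qed.

Lemma system_size_ge e :
  (e <= system_size (rowsub fold_row (stage n.+3 (2 ^ e) 0))
     (rowsub fold_row (stage_rhs n.+3)))%N.
Proof.
have [i iE] := fold_row_surj ord0.
apply: leq_trans (leq_addr _ _).
rewrite (bigD1 i) //= (bigD1 ord0) //= -addnA; apply: leq_trans (leq_addr _ _).
by apply/ltnW/int_size_gt; rewrite !mxE iE /=; lia.
Qed.

End RepeatedStage.

Theorem theorem5p1 (R : realType) (m n : nat) (hn : (3 <= n)%N) (hmn : (n <= m)%N) :
  exists c : R, 0 < c /\
  exists (A : nat -> 'M[int]_(m, n)) (b : nat -> 'cV[int]_m),
    (forall j, \rank (intmx R (A j)) = n) /\
    (forall j (i : 'I_m), primitive (row i (A j))) /\
    ((system_size (A j) (b j))%:R : R) @[j --> \oo] --> +oo /\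
    (forall j, exists k : nat, is_scr R (A j) (b j) k /\
       2 `^ (c * (system_size (A j) (b j))%:R) <= k%:R) /\
    (forall j, ((2 `^ (c * (system_size (A j) (b j))%:R))%:E <= scr_mx R (A j))%E).
Proof.
case: n hn hmn => [|[|[|n]]] // _ nm.
pose M := (m * n.+3 + m)%N.
have M_gt0 : (0 < M)%N by rewrite addn_gt0 (leq_trans _ nm) // orbT.
pose f := @fold_row m n.
pose A j := rowsub f (stage n.+3 (2 ^ j.+1) 0).
pose b (j : nat) := rowsub f (stage_rhs n.+3).
have scr j : is_scr R (A j) (b j) (2 ^ j.+1).
  have k_gt0 : (0 < 2 ^ j.+1)%N by rewrite expn_gt0.
  have [top least] := @is_scr_stage R n _ k_gt0.
  split; first by rewrite scr_level_rowsub //; exact: fold_row_surj.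
  by move=> d; rewrite scr_level_rowsub; [exact: least | exact: fold_row_surj].
(* The size is at most [M * (j + 3)], hence at most [3 * M] times the exponent
   [j + 1] of the rank. *)
have size_le j : 2 `^ ((3 * M%:R)^-1 * (system_size (A j) (b j))%:R) <= (2 ^ j.+1)%:R :> R.
  rewrite natrX -powR_mulrn // ler_powR ?ler1n // ler_pdivrMl ?mulr_gt0 ?ltr0n //.
  rewrite -!natrM ler_nat (leq_trans (system_size_le _ _)) // -/M.
  by rewrite mulnAC mulnC leq_mul2r; lia.
exists (3 * M%:R)^-1; split; first by rewrite invr_gt0 mulr_gt0 // ltr0n.
exists A, b; split=> [j|].
  apply: mxrank_rowsub; first exact: fold_row_surj.
  by have : row_free (intmx R (stage n.+3 (2 ^ j.+1) 0)) by [apply: stage_free; rewrite expn_gt0]; move/eqP.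
split=> [j i|].
  have [c cE] := @stage_unit_entry n (2 ^ j.+1) 0 (f i).
  by apply: (@primitive_unit_entry _ _ c); rewrite mxE [rowsub _ _ _ _]mxE.
split.
  apply/cvgryPge => x; have /cvgryPge/(_ x) := @cvgr_idn R.
  apply: filterS => j /le_trans; apply; rewrite ler_nat.
  exact: leq_trans (system_size_ge nm _).
split=> j; first by exists (2 ^ j.+1)%N.
apply: (@le_trans _ _ (((2 ^ j.+1)%:R : R)%:E)); first by rewrite lee_fin.
apply: ereal_sup_ubound; exists (2 ^ j.+1)%N => //.
by exists (b j).
Qed.
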